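(* Let $X$ be a real-valued random variable with distribution function $F(x)=\mathbb{P}(X\le x)$, $-\infty<x<\infty$, and let $\{X_n;\ n\ge 1\}$ be a sequence of i.i.d. random variables with common distribution function $F$. Let $$\rho_1=\sup\left\{r\ge 0:\ \lim_{x\to\infty}x^r\,\mathbb{P}(X>x)=0\right\},\qquad \rho_2=\sup\left\{r\ge 0:\ \liminf_{x\to\infty}x^r\,\mathbb{P}(X>x)=0\right\},$$ and let $\rho\in[0,\infty]$. Then the following four statements are equivalent: (a) $\displaystyle\lim_{n\to\infty}\frac{\log\max_{1\le k\le n}X_k}{\log n}=\frac1\rho$ almost surely; (b) $\displaystyle\frac{\log\max_{1\le k\le n}X_k}{\log n}\to\frac1\rho$ in probability; (c) $\rho_1=\rho_2=\rho$; (d) $\lim_{x\to\infty}x^r\,\mathbb{P}(X>x)=0$ for all $r<\rho$ if $\rho>0$, and $\lim_{x\to\infty}x^r\,\mathbb{P}(X>x)=\infty$ for all $r>\rho$ if $\rho<\infty$. Moreover, if $0\le\rho<\infty$, then any one of (a)-(d) holds if and only if there exists a function $L:(0,\infty)\to(0,\infty)$ such that $$\mathbb{P}(X>x)\sim\frac{L(x)}{x^\rho}\ \text{ as }x\to\infty\qquad\text{and}\qquad\lim_{x\to\infty}\frac{\ln L(x)}{\ln x}=0.$$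
   Context: Convention: $\log x=\ln(e\vee x)=\ln\max(e,x)$ for all $-\infty<x<\infty$, where $\ln$ is the natural logarithm. Also $1/0=\infty$ and $1/\infty=0$. When $\rho=0$, convergence to $1/\rho=\infty$ in probability of random variables $Y_n$ means $\mathbb{P}(Y_n>M)\to1$ for every $M<\infty$. The notation $f(x)\sim g(x)$ means $f(x)/g(x)\to1$. *)

(* Defs.v *)
From HB Require Import structures.
From mathcomp Require Import all_boot all_order all_algebra finmap.
From mathcomp Require Import all_classical all_reals all_analysis.

Set Implicit Arguments.
Unset Strict Implicit.
Unset Printing Implicit Defensive.

Import Order.TTheory GRing.Theory Num.Theory.
Import numFieldTopology.Exports numFieldNormedType.Exports.

Local Open Scope classical_set_scope.
Local Open Scope ring_scope.
Local Open Scope ereal_scope.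

(* Truncated logarithm, defined on all of R: it is 1 on ]-oo, e]. *)
Definition elog (R : realType) (x : R) : R := ln (Num.max (expR 1) x).

Definition independent_RVs (d : measure_display) (T : measurableType d)
    (R : realType) (P : probability T R) (I : choiceType)
    (X_ : I -> {RV P >-> R}) : Prop :=
  forall (J : {fset I}) (B : I -> set R), (forall i, measurable (B i)) ->
    P (\bigcap_(i in [set` J]) (X_ i @^-1` B i)) =
    \prod_(i <- J) P (X_ i @^-1` B i).

(* The limit is a constant, possibly infinite; for an infinite limit the
   probability that [Y n] passes any given level tends to 1. *)
Definition cvg_in_probability (d : measure_display) (T : measurableType d)
    (R : realType) (P : probability T R) (Y : nat -> T -> R) (l : \bar R)
    : Prop :=
  match l with
  | a%:E => forall e : R, (0 < e)%R ->
      P [set w | (e < `|Y n w - a|)%R] @[n --> \oo] --> 0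
  | +oo => forall M : R, P [set w | (M < Y n w)%R] @[n --> \oo] --> 1
  | -oo => forall M : R, P [set w | (Y n w < M)%R] @[n --> \oo] --> 1
  end.

(* log (max (X_1, ..., X_n)) / log n.  The sequence is indexed from 0, so
   [X_ k] stands for X_(k+1); the index [X_ 0] of the big operator belongs to
   the family as soon as 0 < n, hence does not change the maximum. *)
Definition log_max_ratio (R : realType) (T : Type) (X_ : nat -> T -> R)
    (n : nat) (w : T) : R :=
  (elog (\big[Num.max/X_ 0%N w]_(k < n) X_ k w) / elog n%:R)%R.

(* x^r P(X > x); only its behaviour as x --> +oo is used. *)
Definition scaled_tail (d : measure_display) (T : measurableType d)
    (R : realType) (P : probability T R) (X : {RV P >-> R}) (r x : R)
    : \bar R :=
  (x `^ r)%:E * ccdf X x.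

Definition rho1 (d : measure_display) (T : measurableType d)
    (R : realType) (P : probability T R) (X : {RV P >-> R}) : \bar R :=
  ereal_sup [set r%:E | r in [set r : R |
    (0 <= r)%R /\ scaled_tail X r x @[x --> +oo%R] --> 0]].

Definition rho2 (d : measure_display) (T : measurableType d)
    (R : realType) (P : probability T R) (X : {RV P >-> R}) : \bar R :=
  ereal_sup [set r%:E | r in [set r : R |
    (0 <= r)%R /\ limf_einf (scaled_tail X r) +oo%R = 0]].

(* Main.v *)
Require Import Defs.
From HB Require Import structures.
From mathcomp Require Import all_boot all_order all_algebra finmap.
From mathcomp Require Import all_classical all_reals all_analysis.
From mathcomp Require Import measurable_realfun.
From mathcomp Require Import ring lra.

Import Order.TTheory GRing.Theory Num.Theory.
Import numFieldTopology.Exports numFieldNormedType.Exports.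

Local Open Scope classical_set_scope.
Local Open Scope ring_scope.

(* Let G x = P (X > x) and M_n = max (X_1, ..., X_n).  All five conditions amount
   to G x = x^(-rho + o(1)) as x tends to infinity: eventually G x <= x^-r for
   each r < rho ([tail_le]) and G x >= x^-r for each r > rho ([tail_ge]).
   For (c) and (d) this is a comparison of powers, and for the last condition
   one takes L x = x^rho G x.  For (a) and (b), with Y_n the ratio of logarithms
   and b > 0, the event Y_n <= b is eventually M_n <= n^b, of probability
   (1 - G (n^b))^n.  If b < 1/rho, [tail_ge] bounds it by exp (- n^q), q > 0,
   which is summable; if b > 1/rho, [tail_le] makes P (X_n > n^b) summable; so
   only the first Borel-Cantelli lemma is needed for (a).  Conversely, if
   (1 - G (n^b))^n tends to 1 (resp. 0) then n G (n^b) is eventually at most 1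
   (resp. at least 1/2), and monotonicity of G fills the gaps between the points
   n^b. *)

(** * Conditions on the tail *)

Lemma ereal_between {R : realType} (x y : \bar R) :
  (x < y)%E -> exists r : R, (x < r%:E)%E /\ (r%:E < y)%E.
Proof.
case: x y => [a| |] [b| |] //= xy.
- by exists ((a + b) / 2); rewrite !lte_fin in xy *; split; lra.
- by exists (a + 1); rewrite lte_fin ltry; split => //; lra.
- by exists (b - 1); rewrite lte_fin ltNyr; split => //; lra.
- by exists 0; rewrite ltNyr ltry.
Qed.

Lemma near_powR_ge {R : realType} (s A : R) : 0 < s ->
  \forall x \near +oo, A <= x `^ s.
Proof.
move=> s0; have A1 : 0 < Num.max A 1 by rewrite lt_max ltr01 orbT.
near=> x; have : (Num.max A 1) `^ s^-1 <= x by near: x; exact: nbhs_pinfty_ge.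
move=> h; have x0 : 0 <= x by rewrite (le_trans _ h)// powR_ge0.
have := ge0_ler_powR (ltW s0) _ _ h; rewrite !nnegrE powR_ge0 => /(_ erefl x0).
rewrite -powRrM mulVf ?gt_eqF// powRr1 ?(ltW A1)//.
by rewrite ge_max => /andP[].
Unshelve. all: by end_near. Qed.

Lemma cvg_powR_pinfty {R : realType} (s : R) : 0 < s ->
  x `^ s @[x --> +oo] --> +oo.
Proof. by move=> s0; apply/cvgryPge => A; exact: near_powR_ge. Qed.

(** The gap between [r] and [rho] absorbs any constant factor, so the bound carries none. The
    extreme values need no separate form: for [rho = 0], [tail_le] concerns only negative [r], and
    for [rho = +oo], [tail_ge] is vacuous. *)
Definition tail_le {R : realType} (G : R -> R) (rho : \bar R) :=
  forall r : R, (r%:E < rho)%E -> \forall x \near +oo, G x <= x `^ (- r).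

Definition tail_ge {R : realType} (G : R -> R) (rho : \bar R) :=
  forall r : R, (rho < r%:E)%E -> \forall x \near +oo, x `^ (- r) <= G x.

(** * Tail bounds, limits of x^r P (X > x), and the exponents [rho1] and [rho2] *)

Section scaled_tail.
Context {R : realType} {d : measure_display} {T : measurableType d}.
Context {P : probability T R} (X : {RV P >-> R}).

Definition tail (x : R) : R := fine (ccdf X x).

Lemma tailE x : ccdf X x = (tail x)%:E.
Proof. by rewrite /tail fineK// fin_num_measure. Qed.

Lemma tail_ge0 x : 0 <= tail x.
Proof. by rewrite -lee_fin -tailE. Qed.

Lemma tail_le1 x : tail x <= 1.
Proof. by rewrite -lee_fin -tailE; exact: probability_le1. Qed.

Lemma tail_nonincreasing x y : x <= y -> tail y <= tail x.
Proof. by move=> xy; rewrite -lee_fin -!tailE; exact: ccdf_nonincreasing. Qed.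

Lemma scaled_tailE r x : scaled_tail X r x = (x `^ r * tail x)%:E.
Proof. by rewrite /scaled_tail tailE. Qed.

Lemma scaled_tail_ge0 r x : (0 <= scaled_tail X r x)%E.
Proof. by rewrite scaled_tailE lee_fin mulr_ge0 ?powR_ge0 ?tail_ge0. Qed.

Lemma scaled_tail_le1 r x : 0 < x ->
  (scaled_tail X r x <= 1)%E = (tail x <= x `^ (- r)).
Proof.
move=> x0; rewrite scaled_tailE lee_fin powRN.
by rewrite -[RHS](ler_pM2l (powR_gt0 r x0)) divff// gt_eqF// powR_gt0.
Qed.

Lemma scaled_tail_ge1 r x : 0 < x ->
  (1 <= scaled_tail X r x)%E = (x `^ (- r) <= tail x).
Proof.
move=> x0; rewrite scaled_tailE lee_fin powRN.
by rewrite -[RHS](ler_pM2l (powR_gt0 r x0)) divff// gt_eqF// powR_gt0.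
Qed.

Lemma cvg_scaled_tail_le r : (scaled_tail X r x @[x --> +oo%R] --> 0)%E ->
  \forall x \near +oo, tail x <= x `^ (- r).
Proof.
move=> /fine_cvgP[_ /cvgrPdist_le /(_ _ ltr01)]; apply: filter_app.
near=> x; have x0 : 0 < x by near: x; exact: nbhs_pinfty_gt.
rewrite /= scaled_tailE /= sub0r normrN ger0_norm; last first.
  by rewrite mulr_ge0 ?powR_ge0 ?tail_ge0.
by move=> h; rewrite -scaled_tail_le1// scaled_tailE lee_fin.
Unshelve. all: by end_near. Qed.

Lemma le_cvg_scaled_tail r s : r < s ->
  (\forall x \near +oo, tail x <= x `^ (- s)) ->
  (scaled_tail X r x @[x --> +oo%R] --> 0)%E.
Proof.
move=> rs h; apply: cvg_EFin.
  by apply: nearW => x; rewrite scaled_tailE.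
apply/cvgrPdist_le => /= e e0; near=> x.
have x0 : 0 < x by near: x; exact: nbhs_pinfty_gt.
rewrite scaled_tailE /= sub0r normrN ger0_norm; last first.
  by rewrite mulr_ge0 ?powR_ge0 ?tail_ge0.
apply: (@le_trans _ _ (x `^ r * x `^ (- s))).
  by rewrite ler_wpM2l ?powR_ge0//; near: x.
rewrite -powRD; last by rewrite (gt_eqF x0) implybT.
(* Taking inverses leaves e^-1 <= x^(s - r), a positive power against a constant. *)
rewrite -[e]invrK -opprB powRN lef_pV2 ?posrE ?invr_gt0 ?powR_gt0//.
near: x; apply: near_powR_ge; lra.
Unshelve. all: by end_near. Qed.

(** The constant [c] serves [tail_ge_rho2], where a positive lower limit bounds x^r P (X > x) below
    by some unspecified [c]; the factor x^(s - r) outgrows c^-1. *)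
Lemma ge_cvg_scaled_tail r s (c : R) : r < s -> 0 < c ->
  (\forall x \near +oo, c * x `^ (- r) <= tail x) ->
  (scaled_tail X s x @[x --> +oo%R] --> +oo)%E.
Proof.
move=> rs c0 h; apply/cvgeyPge => A; near=> x.
have x0 : 0 < x by near: x; exact: nbhs_pinfty_gt.
rewrite scaled_tailE lee_fin.
apply: (@le_trans _ _ (x `^ s * (c * x `^ (- r)))); last first.
  by rewrite ler_wpM2l ?powR_ge0//; near: x.
rewrite mulrCA -powRD; last by rewrite (gt_eqF x0) implybT.
rewrite -ler_pdivrMl//; near: x; apply: near_powR_ge; lra.
Unshelve. all: by end_near. Qed.

Lemma near_tail_leW r s : r <= s ->
  (\forall x \near +oo, tail x <= x `^ (- s)) ->
  \forall x \near +oo, tail x <= x `^ (- r).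
Proof.
move=> rs; apply: filter_app; near=> x => /le_trans; apply.
by rewrite ler_powR ?lerN2//; near: x; exact: nbhs_pinfty_ge.
Unshelve. all: by end_near. Qed.

Lemma near_tail_le_neg r : r <= 0 -> \forall x \near +oo, tail x <= x `^ (- r).
Proof.
move=> r0; apply: (near_tail_leW r 0) => //; near=> x.
by rewrite oppr0 powRr0 tail_le1.
Unshelve. all: by end_near. Qed.

Lemma tail_leP (rho : \bar R) : (0 <= rho)%E ->
  (tail_le tail rho <-> ((0 < rho)%E -> forall r : R, (r%:E < rho)%E ->
             (scaled_tail X r x @[x --> +oo%R] --> 0)%E)).
Proof.
move=> rho0; split=> [h _ r /ereal_between[s [rs /h]] | h r rrho].
  by apply: le_cvg_scaled_tail; rewrite -lte_fin.
have [rho_gt0|] := ltP 0%E rho; first exact/cvg_scaled_tail_le/h.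
move=> rho_le0; apply: near_tail_le_neg; rewrite -lee_fin.
by rewrite (le_trans (ltW rrho)).
Qed.

Lemma tail_geP (rho : \bar R) :
  (tail_ge tail rho <-> ((rho < +oo)%E -> forall r : R, (rho < r%:E)%E ->
             (scaled_tail X r x @[x --> +oo%R] --> +oo)%E)).
Proof.
split=> [h _ r /ereal_between[s [/h rs sr]] | h r rrho].
  apply: (ge_cvg_scaled_tail s r 1) => //.
  by apply: filterS rs => x; rewrite mul1r.
have := h (lt_trans rrho (ltry _)) r rrho => /cvgeyPge /(_ 1).
apply: filter_app; near=> x; have x0 : 0 < x by near: x; exact: nbhs_pinfty_gt.
by rewrite scaled_tail_ge1.
Unshelve. all: by end_near. Qed.

Lemma limf_einf_scaled_tail_ge0 r : (0 <= limf_einf (scaled_tail X r) +oo%R)%E.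
Proof.
rewrite limf_einfE; apply: le_ereal_sup_tmp; exists (ereal_inf (range (scaled_tail X r))).
  by exists setT => //; exact: filterT.
by apply: le_ereal_inf_tmp => _ [x _ <-]; exact: scaled_tail_ge0.
Qed.

(** A zero limit forces a zero lower limit, so the set defining [rho1] is contained in the one
    defining [rho2]. *)
Lemma rho1_le_rho2 : (rho1 X <= rho2 X)%E.
Proof.
apply: ereal_sup_le => _ [r [r0 h] <-]; exists r => //; split => //.
apply/eqP; rewrite eq_le limf_einf_scaled_tail_ge0 andbT limf_einfE.
apply: ge_ereal_sup => _ [V Voo <-]; apply/lee_addgt0Pr => e e0; rewrite add0e.
move/fine_cvgP : h => [_ /cvgrPdist_le /(_ _ e0)] h.
have [x [Vx]] := filter_ex (filterI Voo h).
rewrite /= scaled_tailE /= sub0r normrN ger0_norm; last first.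
  by rewrite mulr_ge0 ?powR_ge0 ?tail_ge0.
move=> xe; apply: ge_ereal_inf; exists (scaled_tail X r x); first by exists x.
by rewrite scaled_tailE lee_fin.
Qed.

Lemma tail_le_rho1 (rho : \bar R) :
  (0 <= rho)%E -> (tail_le tail rho <-> (rho <= rho1 X)%E).
Proof.
move=> rho0; split => [h|h r rrho].
  rewrite leNgt; apply/negP => /ereal_between[r [r1 rrho]].
  (* Exponents in the set of [rho1] are nonnegative, hence the maximum with 0. If it equals 0, the
     scaled tail is [ccdf X] itself, which vanishes at infinity. *)
  have : (rho1 X < (Num.max r 0)%:E)%E by rewrite (lt_le_trans r1)// lee_fin le_max lexx.
  rewrite ltNge => /negP; apply; apply: ereal_sup_ubound; exists (Num.max r 0) => //=.
  split; first by rewrite le_max lexx orbT.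
  have [r0|/ltW r0] := leP r 0; last first.
    by have [s [rs /h]] := ereal_between _ _ rrho; apply: le_cvg_scaled_tail; rewrite -lte_fin.
  rewrite (_ : scaled_tail X 0 = ccdf X); first exact: cvg_ccdfy0.
  by apply/funext => x; rewrite scaled_tailE powRr0 mul1r tailE.
have /ereal_sup_gt[_ [s [_ hs] <-] rs] := lt_le_trans rrho h.
by apply: (near_tail_leW r s); [rewrite -lee_fin ltW | exact: cvg_scaled_tail_le].
Qed.

Lemma tail_ge_rho2 (rho : \bar R) :
  (0 <= rho)%E -> (tail_ge tail rho <-> (rho2 X <= rho)%E).
Proof.
move=> rho0; split => [h|h r rrho].
  apply: ge_ereal_sup => _ [r [r0 hr] <-]; rewrite leNgt; apply/negP => /h rrho.
  have : (1 <= limf_einf (scaled_tail X r) +oo%R)%E; last by rewrite hr lee_fin ler10.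
  rewrite limf_einfE; apply: le_ereal_sup_tmp.
  (* The set where the scaled tail is at least 1 is itself a neighbourhood of infinity, so the lower
     limit is at least 1. *)
  exists (ereal_inf (scaled_tail X r @` [set x | 1 <= scaled_tail X r x]%E)).
    exists [set x | 1 <= scaled_tail X r x]%E => //=.
    near=> x => /=; rewrite scaled_tail_ge1; near: x => //; exact: nbhs_pinfty_gt.
  by apply: le_ereal_inf_tmp => _ [x hx <-].
(* The exponent [s] lies strictly above [rho2 X], so its lower limit is positive and x^s P (X > x)
   eventually exceeds some c > 0; raising [s] to [r] then removes [c]. *)
have [s [rhos sr]] := ereal_between _ _ rrho.
have : (0 < limf_einf (scaled_tail X s) +oo%R)%E.
  rewrite lt_neqAle limf_einf_scaled_tail_ge0 andbT eq_sym; apply/eqP => h0.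
  have : (s%:E <= rho2 X)%E.
    apply: ereal_sup_ubound; exists s => //; split => //.
    by rewrite -lee_fin (le_trans rho0)// ltW.
  by rewrite leNgt => /negP; apply; exact: le_lt_trans rhos.
rewrite limf_einfE => /ereal_sup_gt[_ [V Voo <-]] /ereal_between[c [c0 cV]].
suff /cvgeyPge /(_ 1) : (scaled_tail X r x @[x --> +oo%R] --> +oo)%E.
  apply: filter_app; near=> x; have x0 : 0 < x by near: x; exact: nbhs_pinfty_gt.
  by rewrite scaled_tail_ge1.
apply: (ge_cvg_scaled_tail s r c); rewrite -?lte_fin//; near=> x.
have x0 : 0 < x by near: x; exact: nbhs_pinfty_gt.
have Vx : V x by near: x.
have : (c%:E <= scaled_tail X s x)%E.
  by rewrite (le_trans (ltW cV))//; apply: ereal_inf_lbound; exists x.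
by rewrite scaled_tailE lee_fin powRN ler_pdivrMr ?powR_gt0// mulrC.
Unshelve. all: by end_near. Qed.

Lemma tail_rhoP (rho : \bar R) : (0 <= rho)%E ->
  (tail_le tail rho /\ tail_ge tail rho) <-> (rho1 X = rho /\ rho2 X = rho).
Proof.
move=> rho0; rewrite tail_le_rho1// tail_ge_rho2//; split.
  move=> [h1 h2]; have h3 := rho1_le_rho2.
  by split; apply/eqP; rewrite eq_le ?h1 ?h2 ?(le_trans h1 h3) ?(le_trans h3 h2).
by move=> [-> ->].
Qed.

End scaled_tail.

(** * Tails of the form L x / x^rho *)

Section slowly_growing_factor.
Context {R : realType} {d : measure_display} {T : measurableType d}.
Context {P : probability T R} (X : {RV P >-> R}).

(** Positivity far out, given by one exponent above the finite [rho], spreads to every [x] by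
    monotonicity. It allows taking logarithms of the tail and makes L x = x^rho P (X > x)
    positive. *)
Lemma tail_gt0 (rho : R) x : tail_ge (tail X) rho%:E -> 0 < tail X x.
Proof.
have rho1 : (rho%:E < (rho + 1)%:E)%E by rewrite lte_fin ltrDl.
move=> /(_ _ rho1) h.
have : \forall y \near +oo, 0 < y /\ x <= y.
  near=> y; split; first by near: y; exact: nbhs_pinfty_gt.
  by near: y; apply: nbhs_pinfty_ge; exact: num_real.
move/(filterI h) => /filter_ex[y [hy [y0 xy]]].
by rewrite (lt_le_trans _ (tail_nonincreasing X _ _ xy))// (lt_le_trans _ hy)// powR_gt0.
Unshelve. all: by end_near. Qed.

Lemma near_ln_gt0 : \forall x \near +oo, 0 < ln (x : R).
Proof.
by near=> x; apply: ln_gt0; near: x; exact: nbhs_pinfty_gt.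
Unshelve. all: by end_near. Qed.

Lemma tail_slowly_growing (rho : R) : tail_le (tail X) rho%:E ->
  tail_ge (tail X) rho%:E ->
  (ln (tail X x * x `^ rho) / ln x) @[x --> +oo] --> (0 : R).
Proof.
move=> hle hge; apply/cvgrPdist_le => e e0; near=> x.
have x0 : 0 < x by near: x; exact: nbhs_pinfty_gt.
have lx0 : 0 < ln x by near: x; exact: near_ln_gt0.
have Gx0 := tail_gt0 _ x hge.
rewrite sub0r normrN normrM normfV (gtr0_norm lx0) ler_pdivrMr//.
rewrite lnM ?posrE ?powR_gt0// ln_powR ler_norml.
have : tail X x <= x `^ (- (rho - e)).
  by near: x; apply: hle; rewrite lte_fin; lra.
rewrite -ler_ln ?posrE ?powR_gt0// ln_powR => le1.
have : x `^ (- (rho + e)) <= tail X x.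
  by near: x; apply: hge; rewrite lte_fin; lra.
rewrite -ler_ln ?posrE ?powR_gt0// ln_powR => le2.
by apply/andP; split; lra.
Unshelve. all: by end_near. Qed.

Lemma slowly_growing_bounds (L : R -> R) (e : R) : 0 < e ->
  (forall x, 0 < x -> 0 < L x) -> (ln (L x) / ln x) @[x --> +oo] --> (0 : R) ->
  \forall x \near +oo, x `^ (- e) <= L x <= x `^ e.
Proof.
move=> e0 L0 /cvgrPdist_le /(_ _ e0); apply: filter_app; near=> x.
have x0 : 0 < x by near: x; exact: nbhs_pinfty_gt.
have lx0 : 0 < ln x by near: x; exact: near_ln_gt0.
rewrite sub0r normrN normrM normfV (gtr0_norm lx0) ler_pdivrMr//.
rewrite ler_norml -mulNr -!ln_powR !ler_ln ?posrE ?powR_gt0//; exact: L0.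
Unshelve. all: by end_near. Qed.

Lemma tail_slowly_growingP (rho : R) :
  (tail_le (tail X) rho%:E /\ tail_ge (tail X) rho%:E) <->
  exists L : R -> R,
    [/\ (forall x : R, (0 < x)%R -> (0 < L x)%R),
        (tail X x / (L x / x `^ rho)) @[x --> +oo] --> (1 : R)
      & (ln (L x) / ln x) @[x --> +oo] --> (0 : R)].
Proof.
split=> [[hle hge]|[L [L0 hG hL]]].
  exists (fun x => tail X x * x `^ rho); split; last exact: tail_slowly_growing.
  - by move=> x x0; rewrite mulr_gt0 ?powR_gt0//; exact: tail_gt0 hge.
  - apply/cvgrPdist_le => e e0; near=> x.
    have x0 : 0 < x by near: x; exact: nbhs_pinfty_gt.
    rewrite mulfK ?gt_eqF ?powR_gt0// divff ?subrr ?normr0 ?ltW//.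
    by rewrite gt_eqF//; exact: tail_gt0 hge.
(* The ratio is eventually within 1/2 of 1, hence between 1/2 and 2. *)
have hG2 : \forall x \near +oo,
    2^-1 * (L x / x `^ rho) <= tail X x <= 2 * (L x / x `^ rho).
  have h2 : (0 : R) < 2^-1 by rewrite invr_gt0.
  move/cvgrPdist_le : hG => /(_ _ h2); apply: filter_app; near=> x.
  have x0 : 0 < x by near: x; exact: nbhs_pinfty_gt.
  have q0 : 0 < L x / x `^ rho by rewrite divr_gt0 ?powR_gt0 ?L0.
  rewrite ler_norml -(ler_pdivlMr _ _ q0) -(ler_pdivrMr _ _ q0) => /andP[h1 h3].
  by apply/andP; split; lra.
split=> r; rewrite lte_fin => rrho.
(* The gap rho - r is split in halves: one power absorbs the factor 2, the other absorbs [L]. *)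
- have e0 : 0 < (rho - r) / 2 by lra.
  near=> x.
  have x0 : 0 < x by near: x; exact: nbhs_pinfty_gt.
  have /andP[_ h1] : 2^-1 * (L x / x `^ rho) <= tail X x <= 2 * (L x / x `^ rho)
    by near: x.
  have /andP[_ h2] : x `^ (- ((rho - r) / 2)) <= L x <= x `^ ((rho - r) / 2)
    by near: x; exact: slowly_growing_bounds.
  have h3 : 2 <= x `^ ((rho - r) / 2) by near: x; exact: near_powR_ge.
  apply: (le_trans h1).
  rewrite (_ : - r = (rho - r) / 2 + ((rho - r) / 2 - rho)); last by lra.
  rewrite powRD; last by rewrite (gt_eqF x0) implybT.
  rewrite ler_pM//; first by rewrite ltW// divr_gt0 ?powR_gt0 ?L0.
  rewrite powRB; last by rewrite (gt_eqF x0) implybT.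
  by rewrite ler_pM2r// invr_gt0 powR_gt0.
- have e0 : 0 < (r - rho) / 2 by lra.
  near=> x.
  have x0 : 0 < x by near: x; exact: nbhs_pinfty_gt.
  have /andP[h1 _] : 2^-1 * (L x / x `^ rho) <= tail X x <= 2 * (L x / x `^ rho)
    by near: x.
  have /andP[h2 _] : x `^ (- ((r - rho) / 2)) <= L x <= x `^ ((r - rho) / 2)
    by near: x; exact: slowly_growing_bounds.
  have h3 : 2 <= x `^ ((r - rho) / 2) by near: x; exact: near_powR_ge.
  apply: le_trans h1.
  rewrite (_ : - r = - ((r - rho) / 2) + (- ((r - rho) / 2) - rho)); last by lra.
  rewrite powRD; last by rewrite (gt_eqF x0) implybT.
  rewrite ler_pM ?powR_ge0//; first by rewrite powRN lef_pV2 ?posrE ?powR_gt0.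
  rewrite powRB; last by rewrite (gt_eqF x0) implybT.
  by rewrite ler_pM2r// invr_gt0 powR_gt0.
Unshelve. all: by end_near. Qed.

End slowly_growing_factor.

(** * Borel-Cantelli *)

Section borel_cantelli.
Context {R : realType}.

(** The right-hand side is the integral of t^-(1 + q) over [a, a + 1]. Instead of integrating, (a /
    (a + 1))^-q is bounded below by 1 + q / (a + 1), using exp u >= 1 + u and ln (1 + u) <= u. *)
Lemma powR_telescope (q a : R) : 0 < q -> 0 < a ->
  (a + 1) `^ (- (1 + q)) <= q^-1 * (a `^ (- q) - (a + 1) `^ (- q)).
Proof.
move=> q0 a0; have a1 : 0 < a + 1 by lra.
have z_ge : 1 + q / (a + 1) <= (a / (a + 1)) `^ (- q).
  rewrite /powR gt_eqF ?divr_gt0// (le_trans _ (expR_ge1Dx _))// lerD2l.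
  have -> : a / (a + 1) = 1 + - (a + 1)^-1 by field; rewrite gt_eqF.
  rewrite mulNr -mulrN ler_pM2l// lerNr le_ln1Dx// ltrN2.
  by rewrite invf_lt1// ltrDr.
rewrite ler_pdivlMl// opprD powRD; last by rewrite (gt_eqF a1) implybT.
rewrite (powRN _ 1) powRr1; last exact: ltW.
have -> : a `^ (- q) = (a / (a + 1)) `^ (- q) * (a + 1) `^ (- q).
  by rewrite -powRM ?divr_ge0 ?ltW// divfK// gt_eqF.
rewrite -[X in _ - X]mul1r -mulrBl mulrA ler_wpM2r ?powR_ge0//; lra.
Qed.

Lemma sum_powR_le (p : R) (n : nat) : 1 < p ->
  \sum_(0 <= k < n) k.+1%:R `^ (- p) <= 1 + (p - 1)^-1.
Proof.
move=> p1; have q0 : 0 < p - 1 by lra.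
(* Keeping the subtracted last term of the telescoping sum makes the bound inductive. *)
suff h : \sum_(0 <= k < n.+1) k.+1%:R `^ (- p) <=
    1 + (p - 1)^-1 * (1 - n.+1%:R `^ (- (p - 1))).
  apply: (@le_trans _ _ (\sum_(0 <= k < n.+1) k.+1%:R `^ (- p))).
    by rewrite big_nat_recr//= lerDl powR_ge0.
  by rewrite (le_trans h)// lerD2l ler_piMr ?invr_ge0 ?ltW// gerBl powR_ge0.
elim: n => [|n ih].
  by rewrite big_nat1 powR1 subrr mulr0 addr0.
rewrite big_nat_recr//=.
have n1 : (0 : R) < n.+1%:R by rewrite ltr0n.
have := powR_telescope (p - 1) n.+1%:R q0 n1.
rewrite natr1 addrCA subrr addr0; lra.
Qed.

Context {d : measure_display} {T : measurableType d} (P : probability T R).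

Lemma borel_cantelli_powR (E : nat -> set T) (p : R) : 1 < p ->
  (forall n, measurable (E n)) ->
  (\forall n \near \oo, (P (E n) <= (n%:R `^ (- p))%:E)%E) ->
  {ae P, forall w, \forall n \near \oo, ~ E n w}.
Proof.
(* After the shift the bound holds at every index, and k + N + 1 >= k + 1 > 0 gives P (F k) <= (k +
   1)^-p, away from the base 0. *)
move=> p1 mE [N _ hN]; pose F k := E (k + N.+1)%N.
have mF k : measurable (F k) by exact: mE.
exists (lim_sup_set F); split.
- by apply: bigcap_measurable => // k _; exact: bigcup_measurable.
- apply: lim_sup_set_cvg0 => //.
  apply: (@le_lt_trans _ _ (1 + (p - 1)^-1)%:E); last by rewrite ltry.
  apply: lime_le; first by apply: is_cvg_nneseries => *; exact: measure_ge0.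
  apply: nearW => n; apply: (@le_trans _ _ (\sum_(0 <= k < n) (k.+1%:R `^ (- p))%:E)%E).
    apply: lee_sum => k _; rewrite (le_trans (hN _ _))//=.
      by rewrite (leq_trans (leqnSn _))// leq_addl.
    rewrite lee_fin !powRN lef_pV2 ?posrE ?powR_gt0 ?ltr0n ?addnS//.
    by rewrite ge0_ler_powR ?nnegrE// ?ler_nat ?ltnS ?leq_addr// ltW// (lt_trans _ p1).
  by rewrite sumEFin lee_fin sum_powR_le.
- move=> w; apply: contra_notP => /existsNP[m] /not_implyP[_ h].
  exists (m + N.+1)%N => // n /= mn Enw; apply: h; exists (n - N.+1)%N => /=.
    by rewrite leq_subRL ?(leq_trans _ mn) ?leq_addl// addnC.
  by rewrite /F subnK// (leq_trans _ mn)// leq_addl.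
Qed.

(** The unions of E k over k >= n decrease to the upper limit set, which is null, so their
    probabilities tend to 0 by continuity from above. Finite and infinite limits in (b) both reduce
    to this. *)
Lemma ae_eventually_not_cvg0 (E : nat -> set T) :
  (forall n, measurable (E n)) ->
  {ae P, forall w, \forall n \near \oo, ~ E n w} ->
  (P (E n) @[n --> \oo] --> 0)%E.
Proof.
move=> mE [A [mA PA0 EA]].
have mU n : measurable (\bigcup_(k >= n) E k).
  by apply: bigcup_measurable.
have PE0 : P (lim_sup_set E) = 0%E.
  apply: (subset_measure0 _ mA _ PA0).
    by apply: bigcap_measurable => // k _.
  move=> w hw; apply: EA => -[N _ hN].
  by have [j /= Nj] := hw N I; exact: hN.
have Uoo : (P (\bigcup_(k >= 0) E k) < +oo)%E.
  by rewrite (le_lt_trans (probability_le1 _ _)) ?ltry.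
have hU : (P (\bigcup_(k >= n) E k) @[n --> \oo] --> 0)%E.
  by rewrite -PE0; exact: lim_sup_set_cvg.
apply: (squeeze_cvge _ (cvg_cst _) hU).
apply: nearW => n; rewrite measure_ge0/= le_measure ?inE//.
by move=> w Enw; exists n => /=.
Qed.

End borel_cantelli.

(** * Maxima of independent variables *)

Section log_ratio.
Context {R : realType}.

Lemma elog_ge1 (x : R) : 1 <= elog x.
Proof.
rewrite /elog -[X in X <= _](expRK 1) ler_ln ?posrE ?expR_gt0 ?lt_max ?expR_gt0//.
by rewrite le_max lexx.
Qed.

Lemma elog_ratio_gt0 (x y : R) : 0 < elog x / elog y.
Proof. by rewrite divr_gt0// (lt_le_trans ltr01)// elog_ge1. Qed.

Lemma near_natr (Q : R -> Prop) : (\forall x \near +oo, Q x) ->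
  \forall n \near \oo, Q n%:R.
Proof.
have := @cvgr_idn R; apply.
Qed.

(* The threshold on n does not depend on x, so the events [Y_n <= b] and
   [M_n <= n^b] coincide for all large n. *)
Lemma elog_ratio_le (b : R) : 0 < b -> \forall n \near \oo, forall x : R,
  (elog x / elog n%:R <= b) = (x <= n%:R `^ b).
Proof.
move=> b0; apply: (near_natr (fun y => forall x, (elog x / elog y <= b) = (x <= y `^ b))).
near=> y => x.
have ye : expR 1 <= y by near: y; apply: nbhs_pinfty_ge; exact: num_real.
have yb : expR 1 <= y `^ b by near: y; exact: near_powR_ge.
have y0 : 0 < y by rewrite (lt_le_trans (expR_gt0 1)).
have -> : elog y = ln y by rewrite /elog max_r.
have ly0 : 0 < ln y by rewrite ln_gt0// (lt_le_trans _ ye)// expR_gt1.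
rewrite ler_pdivrMr// -ln_powR /elog ler_ln ?posrE ?powR_gt0//.
  by rewrite ge_max yb.
by rewrite lt_max expR_gt0.
Unshelve. all: by end_near. Qed.

(** Terms beyond [N] satisfy u k <= k^b <= n^b; the earlier ones have a fixed maximum, which n^b
    eventually exceeds. *)
Lemma near_bigmax_le (u : nat -> R) (b : R) : 0 < b ->
  (\forall n \near \oo, u n <= n%:R `^ b) ->
  \forall n \near \oo, \big[Num.max/u 0%N]_(k < n) u k <= n%:R `^ b.
Proof.
move=> b0 [N _ hN]; pose C := \big[Num.max/u 0%N]_(k < N) u k.
near=> n.
have Cn : C <= n%:R `^ b.
  by near: n; apply: (near_natr (fun y => C <= y `^ b)); exact: near_powR_ge.
apply/bigmax_leP; split; first by rewrite (le_trans _ Cn)// bigmax_ge_id.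
move=> k _; have [kN|Nk] := ltnP k N.
  by rewrite (le_trans _ Cn)// (le_bigmax _ _ (Ordinal kN)).
apply: (le_trans (hN k Nk)).
by rewrite ge0_ler_powR ?nnegrE ?ler_nat ?(ltW b0)// ltnW.
Unshelve. all: by end_near. Qed.

Lemma near_powR_natr (b : R) (Q : R -> Prop) : 0 < b ->
  (\forall x \near +oo, Q x) -> \forall n \near \oo, Q (n%:R `^ b).
Proof.
move=> b0 Qoo; apply: (near_natr (fun y => Q (y `^ b))).
exact: (cvg_powR_pinfty _ b0 _ Qoo).
Qed.

Lemma near_expR_powR_le (q : R) : 0 < q ->
  \forall x \near +oo, expR (- (x `^ q)) <= x `^ (- 2).
Proof.
move=> q0; near=> x.
have x0 : 0 < x by near: x; exact: nbhs_pinfty_gt.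
rewrite /powR gt_eqF// ler_expR mulNr lerN2.
rewrite -[expR _](_ : x `^ q = _); last by rewrite /powR gt_eqF.
(* The claim is 2 ln x <= x^q. Sublinearity of [ln] at x^(q/2) gives 2 ln x <= (4/q) x^(q/2), and a
   second factor x^(q/2) dominates 4/q. *)
have h1 : 4 / q <= x `^ (q / 2) by near: x; apply: near_powR_ge; lra.
have h2 := ln_sublinear (powR_gt0 (q / 2) x0).
rewrite ln_powR in h2.
rewrite (_ : q = q / 2 + q / 2); last by lra.
rewrite powRD; last by rewrite (gt_eqF x0) implybT.
apply: (@le_trans _ _ (4 / q * x `^ (q / 2))); last first.
  by rewrite ler_wpM2r// powR_ge0.
rewrite mulrAC ler_pdivlMr//; lra.
Unshelve. all: by end_near. Qed.

Lemma onem_exprn_le_expR (g : R) n : 0 <= g <= 1 ->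
  (1 - g) ^+ n <= expR (- (n%:R * g)).
Proof.
move=> /andP[g0 g1]; rewrite -mulrN expRM_natl lerXn2r ?nnegrE ?expR_ge0 ?subr_ge0//.
exact: expR_ge1Dx.
Qed.

(** Bernoulli's inequality. *)
Lemma onem_exprn_ge (g : R) n : 0 <= g <= 1 -> 1 - n%:R * g <= (1 - g) ^+ n.
Proof.
move=> /andP[g0 g1]; elim: n => [|n ih]; first by rewrite mul0r subr0 expr0.
rewrite exprS; apply: (@le_trans _ _ ((1 - g) * (1 - n%:R * g))); last first.
  by rewrite ler_wpM2l// subr_ge0.
have h : 0 <= n%:R * g * g by rewrite !mulr_ge0.
rewrite -natr1; lra.
Qed.

End log_ratio.

(** * Distribution of the running maximum *)

Section maxima.
Context {R : realType} {d : measure_display} {T : measurableType d}.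
Context {P : probability T R} (X_ : nat -> {RV P >-> R}).

Definition running_max (n : nat) (w : T) : R :=
  \big[Num.max/X_ 0%N w]_(k < n) X_ k w.

Lemma measurable_running_max n : measurable_fun setT (running_max n).
Proof.
rewrite (_ : running_max n =
    fun w => \big[Num.max/X_ 0%N w]_(k <- index_iota 0 n) X_ k w); last first.
  by apply/funext => w; rewrite /running_max big_mkord.
elim: (index_iota 0 n) => [|k s ih].
  by under eq_fun do rewrite big_nil; exact: measurable_funPT.
under eq_fun do rewrite big_cons.
by apply: measurable_maxr => //; exact: measurable_funPT.
Qed.

Lemma measurable_log_max_ratio n : measurable_fun setT (log_max_ratio X_ n).
Proof.
apply: measurable_funM => //.
apply: (measurableT_comp (@measurable_ln R)).
by apply: measurable_maxr => //; exact: measurable_running_max.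
Qed.

Context (X : {RV P >-> R}).
Context (X_indep : independent_RVs X_).
Context (X_distr : forall (n : nat) (x : R), cdf (X_ n) x = cdf X x).

Lemma distr_le n (y : R) : P (X_ n @^-1` `]-oo, y]%classic) = (1 - tail X y)%:E.
Proof.
by rewrite EFinB -tailE -cdf_1_ccdf -(X_distr n).
Qed.

Lemma distr_gt n (y : R) : P [set w | y < X_ n w] = (tail X y)%:E.
Proof.
rewrite -tailE ccdf_1_cdf -(X_distr n) -ccdf_1_cdf /ccdf /distribution /pushforward.
by rewrite set_itvoy.
Qed.

Lemma running_max_le n (y : R) : (0 < n)%N ->
  P [set w | running_max n w <= y] = ((1 - tail X y) ^+ n)%:E.
Proof.
move=> n0; pose J := [fset k in iota 0 n]%fset.
have -> : [set w | running_max n w <= y] =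
    \bigcap_(i in [set` J]) (X_ i @^-1` `]-oo, y]%classic).
  apply/seteqP; split => w /=.
    move=> /bigmax_leP[_ h] k /=; rewrite in_fset/= mem_iota/= add0n => kn.
    by rewrite in_itv/=; exact: (h (Ordinal kn)).
  move=> h; have hk k : (k < n)%N -> X_ k w <= y.
    move=> kn; have := h k; rewrite /= in_itv; apply.
    by rewrite in_fset/= mem_iota.
  (* The default value of the maximum is [X_ 0], which belongs to the family because 0 < n. *)
  by apply/bigmax_leP; split => [|i _]; exact: hk.
rewrite X_indep; last by [].
rewrite (eq_bigr (fun=> (1 - tail X y)%:E)); last by move=> i _; exact: distr_le.
rewrite prodEFin; congr EFin.
rewrite big_const_seq count_predT card_fseq undup_id ?iota_uniq// size_iota.
by rewrite -Monoid.iteropE.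
Qed.

Lemma log_max_ratio_le (b : R) : 0 < b -> \forall n \near \oo,
  P [set w | log_max_ratio X_ n w <= b] = ((1 - tail X (n%:R `^ b)) ^+ n)%:E.
Proof.
move=> b0; near=> n.
have n0 : (0 < n)%N by near: n; exact: nbhs_infty_gt.
have h : forall x : R, (elog x / elog n%:R <= b) = (x <= n%:R `^ b).
  by near: n; exact: elog_ratio_le.
rewrite -running_max_le//; congr (P _); apply/seteqP.
by split => w /=; rewrite /log_max_ratio h.
Unshelve. all: by end_near. Qed.

End maxima.

(** * Almost sure convergence and convergence in probability through level sets *)

Section convergence_in_probability.
Context {R : realType} {d : measure_display} {T : measurableType d}.
Context (P : probability T R) (Y : nat -> T -> R).
Context (mY : forall n, measurable_fun setT (Y n)).

Lemma measurable_le_set n (b : R) : measurable [set w | Y n w <= b].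
Proof.
have := mY n measurableT `]-oo, b]%classic (measurable_itv _).
by rewrite setTI set_itvNyc.
Qed.

Lemma measurable_gt_set n (b : R) : measurable [set w | b < Y n w].
Proof.
have := mY n measurableT `]b, +oo[%classic (measurable_itv _).
by rewrite setTI set_itvoy.
Qed.

Lemma measurable_dist_set n (a e : R) : measurable [set w | e < `|Y n w - a|].
Proof.
have mD : measurable_fun setT (fun w => `|Y n w - a|).
  apply: (measurableT_comp (@normr_measurable R setT)).
  by apply: measurable_funB.
have := mD measurableT `]e, +oo[%classic (measurable_itv _).
by rewrite setTI set_itvoy.
Qed.

Lemma probability_gt_setC n (b : R) :
  P [set w | b < Y n w] = (1 - P [set w | (Y n w <= b)%R])%E.
Proof.
rewrite -probability_setC; last exact: measurable_le_set.
by congr (P _); apply/seteqP; split => w /=; rewrite ltNge => /negP.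
Qed.

Lemma cvg_probability_gt1 (b : R) :
  (P [set w | (b < Y n w)%R] @[n --> \oo] --> 1)%E <->
  (P [set w | (Y n w <= b)%R] @[n --> \oo] --> 0)%E.
Proof.
have fin n : P [set w | Y n w <= b] \is a fin_num.
  by rewrite fin_num_measure//; exact: measurable_le_set.
split => h.
  have : (1 - P [set w | (b < Y n w)%R] @[n --> \oo] --> 1 - 1)%E.
    by apply: cvgeB => //; exact: cvg_cst.
  rewrite subee//; apply: cvg_trans; apply: near_eq_cvg; apply: nearW => n.
  by rewrite probability_gt_setC -(fineK (fin n)) -!EFinB opprB addrCA subrr addr0.
have : (1 - P [set w | (Y n w <= b)%R] @[n --> \oo] --> 1 - 0)%E.
  by apply: cvgeB => //; exact: cvg_cst.
rewrite sube0; apply: cvg_trans; apply: near_eq_cvg; apply: nearW => n.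
by rewrite probability_gt_setC.
Qed.

Lemma ae_cvg_in_probability (l : \bar R) : (0 <= l)%E ->
  {ae P, forall w, ((Y n w)%:E @[n --> \oo] --> l)%E} ->
  cvg_in_probability P Y l.
Proof.
case: l => [a| |] //= _ h.
- move=> e e0; apply: ae_eventually_not_cvg0.
    by move=> n; exact: measurable_dist_set.
  apply: filterS h => w /fine_cvgP[_ /cvgrPdist_le /(_ _ e0)].
  by apply: filterS => n /=; rewrite distrC leNgt => /negP.
- move=> M; apply/cvg_probability_gt1; apply: ae_eventually_not_cvg0.
    by move=> n; exact: measurable_le_set.
  apply: filterS h => w /cvgeyPgt /(_ M).
  by apply: filterS => n /=; rewrite lte_fin ltNge => /negP.
Qed.

Lemma cvg_in_probability_gt (l : \bar R) (b : R) : (0 <= l)%E -> (l < b%:E)%E ->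
  cvg_in_probability P Y l -> (P [set w | (b < Y n w)%R] @[n --> \oo] --> 0)%E.
Proof.
case: l => [a| |] //= _; rewrite lte_fin => ab /(_ ((b - a) / 2)).
move=> /(_ ltac:(lra)); apply: (squeeze_cvge _ (cvg_cst _)).
apply: nearW => n; rewrite measure_ge0/= le_measure ?inE//.
- exact: measurable_gt_set.
- exact: measurable_dist_set.
- by move=> w /= bY; rewrite ltr_normr; apply/orP; left; lra.
Qed.

Lemma cvg_in_probability_le (l : \bar R) (b : R) : (0 <= l)%E -> (b%:E < l)%E ->
  cvg_in_probability P Y l -> (P [set w | (Y n w <= b)%R] @[n --> \oo] --> 0)%E.
Proof.
case: l => [a| |] //= _; last by move=> _ /(_ b) /cvg_probability_gt1.
(* Half the gap, since the deviation must be strict while Y n w = b is allowed. *)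
rewrite lte_fin => ab /(_ ((a - b) / 2)).
move=> /(_ ltac:(lra)); apply: (squeeze_cvge _ (cvg_cst _)).
apply: nearW => n; rewrite measure_ge0/= le_measure ?inE//.
- exact: measurable_le_set.
- exact: measurable_dist_set.
- by move=> w /= bY; rewrite ltr_normr; apply/orP; right; lra.
Qed.

Lemma cvge0_near_le (f : nat -> \bar R) (e : R) : 0 < e ->
  (f n @[n --> \oo] --> 0)%E -> \forall n \near \oo, (f n <= e%:E)%E.
Proof.
move=> e0 /fine_cvgP[fin /cvgrPdist_le /(_ _ e0)]; apply: filter_app.
apply: filterS fin => n fn /=; rewrite sub0r normrN => /(le_trans (ler_norm _)) h.
by rewrite -(fineK fn) lee_fin.
Qed.

Lemma ae_forall_rat (Q : rat -> T -> Prop) :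
  (forall q, {ae P, forall w, Q q w}) -> {ae P, forall w, forall q, Q q w}.
Proof.
move=> h; have /ae_foralln : forall n : nat,
    {ae P, forall w, if (choice.unpickle n : option rat) is Some q then Q q w else True}.
  by move=> n; case: (choice.unpickle n) => [q|]; [exact: h | exact: aeW].
by apply: filterS => w hw q; have := hw (choice.pickle q); rewrite choice.pickleK.
Qed.

Lemma cvg_EFin_bounds (y : nat -> R) (l : \bar R) :
  (forall b : R, (l < b%:E)%E -> \forall n \near \oo, y n <= b) ->
  (forall b : R, (b%:E < l)%E -> \forall n \near \oo, b <= y n) ->
  ((y n)%:E @[n --> \oo] --> l)%E.
Proof.
case: l => [a| |] hle hge.
- apply: cvg_EFin; first exact: nearW.
  apply/cvgrPdist_le => e e0; near=> n.
  rewrite /= distrC ler_norml; apply/andP; split.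
    rewrite lerBrDl; near: n; apply: hge; rewrite lte_fin; lra.
  rewrite lerBlDl; near: n; apply: hle; rewrite lte_fin; lra.
- apply/cvgeyPge => A; apply: filterS (hge A (ltry _)) => n.
  by rewrite lee_fin.
- apply/cvgeNyPle => A; apply: filterS (hle A (ltNyr _)) => n.
  by rewrite lee_fin.
Unshelve. all: by end_near. Qed.

(** The exceptional null set depends on [b]. Only rational levels are used, so countably many null
    sets are discarded; any other level is separated from [l] by a rational one. *)
Lemma ae_cvg_bounds (l : \bar R) :
  (forall b : R, (l < b%:E)%E -> {ae P, forall w, \forall n \near \oo, Y n w <= b}) ->
  (forall b : R, (b%:E < l)%E -> {ae P, forall w, \forall n \near \oo, b <= Y n w}) ->
  {ae P, forall w, ((Y n w)%:E @[n --> \oo] --> l)%E}.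
Proof.
move=> hle hge.
have h1 : {ae P, forall w, forall q : rat, (l < (ratr q)%:E)%E ->
    \forall n \near \oo, Y n w <= ratr q}.
  apply: ae_forall_rat => q; have [/hle|lq] := boolP (l < (ratr q)%:E)%E.
    by apply: filterS.
  exact: aeW.
have h2 : {ae P, forall w, forall q : rat, ((ratr q)%:E < l)%E ->
    \forall n \near \oo, ratr q <= Y n w}.
  apply: ae_forall_rat => q; have [/hge|lq] := boolP ((ratr q)%:E < l)%E.
    by apply: filterS.
  exact: aeW.
apply: filterS2 h1 h2 => w h1 h2; apply: cvg_EFin_bounds => b.
  move=> /ereal_between[r [lr]]; rewrite lte_fin => /rat_in_itvoo[q].
  rewrite in_itv/= => /andP[rq qb].
  have : (l < (ratr q)%:E)%E by rewrite (lt_trans lr)// lte_fin.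
  by move=> /h1; apply: filterS => n /le_trans; apply; exact: ltW.
move=> /ereal_between[r [+ rl]]; rewrite lte_fin => /rat_in_itvoo[q].
rewrite in_itv/= => /andP[bq qr].
have : ((ratr q)%:E < l)%E by rewrite (lt_trans _ rl)// lte_fin.
by move=> /h2; apply: filterS => n; apply: le_trans; exact: ltW.
Qed.

End convergence_in_probability.

(** * From the tail to the maxima and back *)

Section maxima_tails.
Context {R : realType} {d : measure_display} {T : measurableType d}.
Context {P : probability T R} (X : {RV P >-> R}) (X_ : nat -> {RV P >-> R}).
Context (X_indep : independent_RVs X_).
Context (X_distr : forall (n : nat) (x : R), cdf (X_ n) x = cdf X x).
Context (rho : \bar R) (rho_ge0 : (0 <= rho)%E).

(** The conventions 1/0 = +oo and 1/+oo = 0 make this valid at both ends, which spares a case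
    analysis on [rho] below. *)
Lemma inve_lt_EFin (b : R) : 0 < b -> (rho^-1 < b%:E)%E = ((b^-1)%:E < rho)%E.
Proof.
move=> b0; rewrite inve_plt ?inE ?lee_fin ?(ltW b0)//.
by rewrite inver gt_eqF.
Qed.

Lemma EFin_lt_inve (b : R) : 0 < b -> (b%:E < rho^-1)%E = (rho < (b^-1)%:E)%E.
Proof.
move=> b0; rewrite inve_pgt ?inE ?lee_fin ?(ltW b0)//.
by rewrite inver gt_eqF.
Qed.

(* Applied to the single variables, [X_n > n^b]: the probabilities
   [P (M_n > n^b)] of order [n^(1 - b s)] need not be summable. *)
Lemma tail_le_ae_log_max_ratio (b : R) : tail_le (tail X) rho ->
  (rho^-1 < b%:E)%E ->
  {ae P, forall w, \forall n \near \oo, log_max_ratio X_ n w <= b}.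
Proof.
move=> hle rb.
have b0 : 0 < b by rewrite -lte_fin (le_lt_trans _ rb)// inve_ge0.
move: rb; rewrite inve_lt_EFin// => /ereal_between[s []].
rewrite lte_fin => bs /hle hs.
have bs1 : 1 < b * s by rewrite -ltr_pdivrMl// mulr1.
have : {ae P, forall w, \forall n \near \oo, ~ [set v | n%:R `^ b < X_ n v] w}.
  apply: (borel_cantelli_powR P _ (b * s) bs1).
    by move=> n; apply: (measurable_gt_set (fun k => X_ k : T -> R)) => m;
      exact: measurable_funPT.
  have := near_powR_natr b _ b0 hs; apply: filterS => n.
  by rewrite -powRrM mulrN (distr_gt X_ X)// lee_fin.
apply: filterS => w h.
have : \forall n \near \oo, X_ n w <= n%:R `^ b.
  by apply: filterS h => n /= /negP; rewrite -leNgt.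
move=> /(near_bigmax_le (fun n => X_ n w) b b0); apply: filter_app.
by apply: filterS (elog_ratio_le b b0) => n hn; rewrite -hn.
Qed.

Lemma tail_ge_ae_log_max_ratio (b : R) : tail_ge (tail X) rho ->
  (b%:E < rho^-1)%E ->
  {ae P, forall w, \forall n \near \oo, b <= log_max_ratio X_ n w}.
Proof.
(* Truncated logarithms are at least 1, so the ratio is positive and levels b <= 0 are trivial. *)
move=> hge rb; have [b0|b0] := leP b 0.
  apply: aeW => w; apply: nearW => n.
  by rewrite (le_trans b0)// ltW// elog_ratio_gt0.
move: rb; rewrite EFin_lt_inve// => /ereal_between[s [/hge hs]].
rewrite lte_fin => bs.
(* This is the exponent in n P (X > n^b) >= n^(1 - b s), so (1 - P (X > n^b))^n <= exp (- n^(1 - b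
   s)) <= n^-2 eventually. *)
have bs1 : 0 < 1 - b * s by rewrite subr_gt0 -ltr_pdivlMl// mulr1.
have : {ae P, forall w, \forall n \near \oo,
    ~ [set v | log_max_ratio X_ n v <= b] w}.
  apply: (borel_cantelli_powR P _ 2); first by rewrite ltr1n.
    by move=> n; apply: measurable_le_set; exact: measurable_log_max_ratio.
  have h1 := near_powR_natr b _ b0 hs.
  have h2 := near_natr _ (near_expR_powR_le _ bs1).
  have h3 := log_max_ratio_le X_ X X_indep X_distr b b0.
  near=> n.
  have -> : P [set v | log_max_ratio X_ n v <= b] =
    ((1 - tail X (n%:R `^ b)) ^+ n)%:E by near: n.
  have n0 : (0 : R) < n%:R by rewrite ltr0n; near: n; exact: nbhs_infty_gt.
  rewrite lee_fin (le_trans (onem_exprn_le_expR _ _ _))//.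
    by rewrite tail_ge0 tail_le1.
  have : expR (- (n%:R `^ (1 - b * s))) <= (n%:R : R) `^ (- 2) by near: n.
  apply: le_trans; rewrite ler_expR lerN2.
  rewrite powRD; last by rewrite (gt_eqF n0) implybT.
  rewrite powRr1 ?(ltW n0)// ler_pM2l// -mulrN powRrM; near: n; exact: h1.
apply: filterS => w; apply: filterS => n /= /negP.
by rewrite -ltNge => /ltW.
Unshelve. all: by end_near. Qed.

Lemma in_probability_tail_le :
  cvg_in_probability P (log_max_ratio X_) rho^-1 -> tail_le (tail X) rho.
Proof.
move=> hP r rrho; have [r0|r0] := leP r 0; first exact: near_tail_le_neg.
have [s [rs srho]] := ereal_between _ _ rrho; rewrite lte_fin in rs.
have s0 : 0 < s by exact: lt_trans rs.
have b0 : 0 < s^-1 by rewrite invr_gt0.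
have rb : (rho^-1 < (s^-1)%:E)%E by rewrite inve_lt_EFin// invrK.
have rinv0 : (0 <= rho^-1)%E by rewrite inve_ge0.
have half : (0 : R) < 2^-1 by rewrite invr_gt0.
have /(cvge0_near_le _ _ half) h1 :=
  cvg_in_probability_gt P _ (measurable_log_max_ratio X_) _ _ rinv0 rb hP.
have h2 := log_max_ratio_le X_ X X_indep X_distr _ b0.
(* With g = P (X > n^(1/s)), 1/2 <= (1 - g)^n <= exp (- n g), so 1 + n g <= exp (n g) <= 2. *)
have [N _ hN] : \forall n \near \oo, n%:R * tail X (n%:R `^ s^-1) <= 1.
  near=> n.
  have : (P [set w | (s^-1 < log_max_ratio X_ n w)%R] <= (2^-1)%:E)%E by near: n.
  rewrite probability_gt_setC; last exact: measurable_log_max_ratio.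
  have -> : P [set v | log_max_ratio X_ n v <= s^-1] =
    ((1 - tail X (n%:R `^ s^-1)) ^+ n)%:E by near: n.
  set g := tail X _; have g01 : 0 <= g <= 1 by rewrite tail_ge0 tail_le1.
  rewrite -EFinB lee_fin => h; have := onem_exprn_le_expR g n g01.
  rewrite expRN => h'.
  have h3 : 2^-1 <= (expR (n%:R * g))^-1 by lra.
  rewrite lef_pV2 ?posrE ?expR_gt0// in h3.
  have := expR_ge1Dx (n%:R * g); lra.
near=> x.
have x0 : 0 < x by near: x; exact: nbhs_pinfty_gt.
have xs0 : 0 <= x `^ s by exact: powR_ge0.
have /andP[nx xn] := truncn_itv xs0.
(* Rounding down gives n^(1/s) <= x, hence P (X > x) <= P (X > n^(1/s)) <= 1/n; N + 2 <= x^s ensures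
   n > N, in particular n >= 1. *)
set n := Num.truncn (x `^ s) in nx xn.
have Nx : N.+2%:R <= x `^ s by near: x; exact: near_powR_ge.
have Nn : (N.+1 < n.+1)%N.
  by rewrite -(ltr_nat R) (lt_trans _ (le_lt_trans Nx xn))// ltr_nat.
have n1 : (1 : R) <= n%:R by rewrite ler1n -ltnS (leq_trans _ Nn).
have xE : (x `^ s) `^ s^-1 = x.
  by rewrite -powRrM divff ?gt_eqF// powRr1// ltW.
have nbx : n%:R `^ s^-1 <= x.
  rewrite -[leRHS]xE.
  by apply: (ge0_ler_powR (ltW b0)) => //; rewrite ?nnegrE.
apply: (le_trans (tail_nonincreasing X _ _ nbx)).
have := hN n; rewrite /= -ltnS => /(_ (ltnW Nn)).
have n0 : (0 : R) < n%:R by rewrite (lt_le_trans _ n1).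
rewrite -ler_pdivlMl// mulr1 => /le_trans; apply.
rewrite powRN lef_pV2 ?posrE ?powR_gt0//.
(* Then 2 x^r <= x^s < n + 1 <= 2 n, that is, 1/n <= x^-r. *)
have h3 : 2 <= x `^ (s - r) by near: x; apply: near_powR_ge; lra.
have h4 : x `^ r * x `^ (s - r) = x `^ s.
  by rewrite -powRD ?(gt_eqF x0) ?implybT// addrC subrK.
have h5 : x `^ r * 2 <= x `^ s by rewrite -h4 ler_pM2l ?powR_gt0.
move: xn; rewrite -natr1; lra.
Unshelve. all: by end_near. Qed.

Lemma in_probability_tail_ge :
  cvg_in_probability P (log_max_ratio X_) rho^-1 -> tail_ge (tail X) rho.
Proof.
move=> hP r rrho.
have [s [rhos sr]] := ereal_between _ _ rrho; rewrite lte_fin in sr.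
have s0 : 0 < s by rewrite -lte_fin (le_lt_trans _ rhos).
have b0 : 0 < s^-1 by rewrite invr_gt0.
have rb : ((s^-1)%:E < rho^-1)%E by rewrite EFin_lt_inve// invrK.
have rinv0 : (0 <= rho^-1)%E by rewrite inve_ge0.
have half : (0 : R) < 2^-1 by rewrite invr_gt0.
have /(cvge0_near_le _ _ half) h1 :=
  cvg_in_probability_le P _ (measurable_log_max_ratio X_) _ _ rinv0 rb hP.
have h2 := log_max_ratio_le X_ X X_indep X_distr _ b0.
(* Bernoulli's inequality gives 1 - n g <= (1 - g)^n <= 1/2. *)
have [N _ hN] : \forall n \near \oo, 2^-1 <= n%:R * tail X (n%:R `^ s^-1).
  near=> n.
  have : (P [set w | (log_max_ratio X_ n w <= s^-1)%R] <= (2^-1)%:E)%E by near: n.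
  have -> : P [set v | log_max_ratio X_ n v <= s^-1] =
    ((1 - tail X (n%:R `^ s^-1)) ^+ n)%:E by near: n.
  set g := tail X _; have g01 : 0 <= g <= 1 by rewrite tail_ge0 tail_le1.
  rewrite lee_fin; have := onem_exprn_ge g n g01; lra.
near=> x.
have x0 : 0 < x by near: x; exact: nbhs_pinfty_gt.
have xs0 : 0 <= x `^ s by exact: powR_ge0.
have /andP[nx xn] := truncn_itv xs0.
set n := Num.truncn (x `^ s) in nx xn.
have Nx : N.+1%:R <= x `^ s by near: x; exact: near_powR_ge.
have Nn : (N <= n.+1)%N.
  by rewrite ltnW// -(ltr_nat R) (lt_trans _ (le_lt_trans Nx xn))// ltr_nat.
have xE : (x `^ s) `^ s^-1 = x.
  by rewrite -powRrM divff ?gt_eqF// powRr1// ltW.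
(* A lower bound on the tail needs a point to the right of [x], hence n + 1 here. *)
have xnb : x <= n.+1%:R `^ s^-1.
  rewrite -[leLHS]xE.
  by apply: (ge0_ler_powR (ltW b0)); rewrite ?nnegrE// ltW.
apply: le_trans (tail_nonincreasing X _ _ xnb).
have n0 : (0 : R) < n.+1%:R by [].
have := hN n.+1 Nn; rewrite -ler_pdivrMl//; apply: le_trans.
rewrite powRN -invfM lef_pV2 ?posrE ?powR_gt0 ?mulr_gt0//.
(* With x^s >= 1, 2 (n + 1) <= 2 (x^s + 1) <= 4 x^s <= x^r. *)
have h3 : 4 <= x `^ (r - s) by near: x; apply: near_powR_ge; lra.
have h4 : x `^ s * x `^ (r - s) = x `^ r.
  by rewrite -powRD ?(gt_eqF x0) ?implybT// addrC subrK.
have h5 : x `^ s * 4 <= x `^ r by rewrite -h4 ler_pM2l ?powR_gt0.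
have h6 : 1 <= x `^ s by near: x; exact: near_powR_ge.
rewrite -natr1; lra.
Unshelve. all: by end_near. Qed.

End maxima_tails.

Local Open Scope ereal_scope.

Theorem theorem2p3 (R : realType) (d : measure_display) (T : measurableType d)
    (P : probability T R) (X : {RV P >-> R}) (X_ : nat -> {RV P >-> R})
    (X_indep : independent_RVs X_)
    (X_distr : forall (n : nat) (x : R), cdf (X_ n) x = cdf X x)
    (rho : \bar R) (rho_ge0 : 0 <= rho) :
  let st_a := {ae P, forall w,
             (log_max_ratio X_ n w)%:E @[n --> \oo] --> rho^-1} in
  let st_b := cvg_in_probability P (log_max_ratio X_) rho^-1 in
  let st_c := rho1 X = rho /\ rho2 X = rho in
  let st_d := (0 < rho -> forall r : R, r%:E < rho ->
             scaled_tail X r x @[x --> +oo%R] --> 0) /\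
           (rho < +oo -> forall r : R, rho < r%:E ->
             scaled_tail X r x @[x --> +oo%R] --> +oo) in
  let st_e := exists L : R -> R,
             [/\ (forall x : R, (0 < x)%R -> (0 < L x)%R),
                 (fine (ccdf X x) / (L x / x `^ fine rho))%R
                   @[x --> +oo%R] --> (1 : R)%R
               & (ln (L x) / ln x)%R @[x --> +oo%R] --> (0 : R)%R] in
  [/\ (st_a <-> st_b), (st_b <-> st_c) & (st_c <-> st_d)] /\
  (rho < +oo ->
    [/\ (st_a <-> st_e), (st_b <-> st_e), (st_c <-> st_e) & (st_d <-> st_e)]).
Proof.
move=> st_a st_b st_c st_d st_e.
(* The pair of tail bounds is the hub: (a), (b) and it form a cycle of implications, and each other
   condition is equivalent to it. *)
pose st_t := tail_le (tail X) rho /\ tail_ge (tail X) rho.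
have rinv0 : 0 <= rho^-1 by rewrite inve_ge0.
have ab : st_a -> st_b.
  by apply: ae_cvg_in_probability => //; exact: measurable_log_max_ratio.
have bt : st_b -> st_t.
  move=> hb; split.
    exact: (in_probability_tail_le X X_ X_indep X_distr rho rho_ge0 hb).
  exact: (in_probability_tail_ge X X_ X_indep X_distr rho rho_ge0 hb).
have ta : st_t -> st_a.
  move=> [hle hge]; apply: ae_cvg_bounds => b hb.
    exact: (tail_le_ae_log_max_ratio X X_ X_distr rho rho_ge0 b hle hb).
  exact: (tail_ge_ae_log_max_ratio X X_ X_indep X_distr rho rho_ge0 b hge hb).
have tc : st_t <-> st_c by exact: tail_rhoP.
have td : st_t <-> st_d.
  by rewrite /st_t /st_d tail_leP// tail_geP.
have te : rho < +oo -> (st_t <-> st_e).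
  rewrite /st_t /st_e; case: (rho) rho_ge0 => [a| |] // _ _.
  exact: tail_slowly_growingP.
by split; [split; tauto | move=> /te {}te; split; tauto].
Qed.
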